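(* Consider the linear-quadratic subspace Stackelberg game described in the context and assume that $\varphi$ is $\sigma_\varphi$-strongly convex (jointly in $(x,y)$, $\sigma_\varphi>0$). Let $L_{J\varphi_e}>0$ be a Lipschitz constant of $\nabla\varphi_e$ and let $\alpha^k=\alpha$ for all $k\in\mathbb N$ with $\alpha\in(0,L_{J\varphi_e}^{-1}]$. Then there exists a constant $\bar\beta>0$ such that, if $\beta^k=\beta$ for all $k$ with $\beta\in(0,\bar\beta)$, the sequence $\{(x^k,y^k,s^k)\}_{k\in\mathbb N}$ generated by single-loop BIG Hype (defined in the context), from any $x^0\in\mathcal X$, $y^0\in\mathbb R^n$, $s^0\in\mathbb R^{n\times m}$, converges at a linear (geometric) rate to $(x^\star,y^\star(x^\star),W)$, where $x^\star$ is the unique solution of $\min_{x\in\mathcal X}\varphi_e(x)$.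
   Context: **Linear-quadratic subspace game.** Followers $i=1,\dots,N$ choose $y_i\in\mathbb R^{n_i}$; $y=(y_1,\dots,y_N)\in\mathbb R^n$, $n=\sum_in_i$. The leader chooses $x\in\mathcal X\subseteq\mathbb R^m$. Follower $i$ minimizes $f_i(x,y)=\tfrac12y_i^\top Q_iy_i+\big(\sum_{j=1}^NE_{i,j}y_j+E_{i,0}x+e_i\big)^\top y_i$ (with $Q_i$ symmetric positive definite) over $y_i\in\mathcal Y_i(x):=\{y_i:C_iy_i=d_i+H_ix\}$, where $C_i$ has full row rank. As a function of $y_i$, $f_i$ is assumed convex. Let $\mathcal Y(x)=\prod_i\mathcal Y_i(x)$ and let $F(x,y)=(\nabla_{y_i}f_i(x,y))_{i=1}^N$ be the (affine) pseudo-gradient, assumed $\mu$-strongly monotone ($\mu>0$) and $L_F$-Lipschitz in $y$. **Leader.** $\varphi:\mathbb R^m\times\mathbb R^n\to\mathbb R$ is definable (in a fixed o-minimal structure expanding the real field) and continuously differentiable, with Lipschitz partial gradients $\nabla_1\varphi,\nabla_2\varphi$; $\mathcal X$ is nonempty, convex and compact. **Solution map.** $y^\star(x)$ is the unique solution of the variational inequality $\mathrm{VI}(F(x,\cdot),\mathcal Y(x))$ (the unique Nash equilibrium); it is affine in $x$: $y^\star(x)=Wx+w$. Put $\varphi_e(x)=\varphi(x,y^\star(x))$, whose gradient is Lipschitz. Fix $0<\gamma<2\mu/L_F^2$ and let $h(x,y)=\mathbb P_{\mathcal Y(x)}[y-\gamma F(x,y)]$ (Euclidean projection); $h$ is affine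 in $(x,y)$, with constant partial Jacobians $\mathrm J_1h\in\mathbb R^{n\times m}$ and $\mathrm J_2h\in\mathbb R^{n\times n}$. **Single-loop BIG Hype.** For $k=0,1,\dots$: $\widehat\nabla\varphi_e^k=\nabla_1\varphi(x^k,y^k)+(s^k)^\top\nabla_2\varphi(x^k,y^k)$; $x^{k+1}=x^k+\beta^k\big(\mathbb P_{\mathcal X}[x^k-\alpha^k\widehat\nabla\varphi_e^k]-x^k\big)$; $y^{k+1}=h(x^{k+1},y^k)$; $s^{k+1}=\mathrm J_2h\,s^k+\mathrm J_1h$. Linear rate means that the distance to the limit is bounded by $C\rho^k$ for some $C>0$, $\rho\in(0,1)$. *)

(* Defs.v *)
From mathcomp Require Import all_boot all_order all_algebra.
From mathcomp Require Import all_classical all_reals all_analysis.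

Set Implicit Arguments.
Unset Strict Implicit.
Unset Printing Implicit Defensive.

Import Order.TTheory GRing.Theory Num.Theory.
Import numFieldNormedType.Exports.

Local Open Scope classical_set_scope.
Local Open Scope ring_scope.

(* The library norm `|_| on matrices is the max norm; the Euclidean one is
   needed here. *)
Definition dotv (R : realType) (p : nat) (u v : 'cV[R]_p) : R :=
  (u^T *m v) 0 0.

(* Euclidean norm on columns, Frobenius norm on general matrices. *)
Definition enorm (R : realType) (p q : nat) (A : 'M[R]_(p, q)) : R :=
  Num.sqrt (\sum_i \sum_j A i j ^+ 2).

Definition enorm2 (R : realType) (p q : nat) (z : 'cV[R]_p * 'cV[R]_q) : R :=
  Num.sqrt (enorm z.1 ^+ 2 + enorm z.2 ^+ 2).

Definition grad (R : realType) (p : nat) (g : 'cV[R]_p -> R) (u : 'cV[R]_p) :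
    'cV[R]_p :=
  \col_k 'D_(delta_mx k 0) g u.

Definition jac (R : realType) (p q : nat) (g : 'cV[R]_p -> 'cV[R]_q)
    (u : 'cV[R]_p) : 'M[R]_(q, p) :=
  \matrix_(i, j) 'D_(delta_mx j 0) (fun v => g v i 0 : R) u.

Definition grad1 (R : realType) (p q : nat) (g : 'cV[R]_p * 'cV[R]_q -> R)
    (z : 'cV[R]_p * 'cV[R]_q) : 'cV[R]_p :=
  grad (fun u => g (u, z.2)) z.1.

Definition grad2 (R : realType) (p q : nat) (g : 'cV[R]_p * 'cV[R]_q -> R)
    (z : 'cV[R]_p * 'cV[R]_q) : 'cV[R]_q :=
  grad (fun v => g (z.1, v)) z.2.

Definition strongly_convex2 (R : realType) (p q : nat) (sigma : R)
    (g : 'cV[R]_p * 'cV[R]_q -> R) : Prop :=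
  forall (t : R) (z z' : 'cV[R]_p * 'cV[R]_q), 0 <= t <= 1 ->
    g (t *: z + (1 - t) *: z') <=
    t * g z + (1 - t) * g z' - sigma / 2 * t * (1 - t) * enorm2 (z - z') ^+ 2.

Definition is_minimizer (T : Type) (R : realType) (K : set T) (g : T -> R)
    (u : T) : Prop :=
  K u /\ forall v, K v -> g u <= g v.

Definition eproj (R : realType) (p : nat) (K : set 'cV[R]_p) (z : 'cV[R]_p) :
    'cV[R]_p :=
  xget 0 [set u | is_minimizer K (fun v => enorm (z - v)) u].

(* S n is the collection of definable subsets of R^n (van den Dries' axioms).
   With the last field, the graphs of + and * make every real algebraic set
   definable. *)
Record o_minimal (R : realType) (S : forall n, set (set 'cV[R]_n)) : Prop := {
  omin_setT : forall n, S n setT;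
  omin_setC : forall n A, S n A -> S n (~` A);
  omin_setU : forall n A B, S n A -> S n B -> S n (A `|` B);
  omin_prodl : forall n A, S n A -> S (1 + n)%N [set z | A (dsubmx z)];
  omin_prodr : forall n A, S n A -> S (n + 1)%N [set z | A (usubmx z)];
  omin_diag : forall n (i j : 'I_n), S n [set z | z i 0 = z j 0];
  omin_proj : forall n (A : set 'cV[R]_(n + 1)),
    S (n + 1)%N A -> S n (usubmx @` A);
  omin_add : S 3%N [set z | z (inord 2) 0 = z (inord 0) 0 + z (inord 1) 0];
  omin_mul : S 3%N [set z | z (inord 2) 0 = z (inord 0) 0 * z (inord 1) 0];
  (* `interval R` covers points and all bounded or unbounded intervals *)
  omin_dim1 : forall A : set 'cV[R]_1,
    S 1%N A <-> exists s : seq (interval R),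
                A = [set z | exists2 I, I \in s & z 0 0 \in I]
}.

Definition definable_fun2 (R : realType) (S : forall n, set (set 'cV[R]_n))
    (p q : nat) (g : 'cV[R]_p * 'cV[R]_q -> R) : Prop :=
  S (p + q + 1)%N
    [set z | dsubmx z 0 0 = g (usubmx (usubmx z), dsubmx (usubmx z))].

(* N followers, follower i having n i variables and p i equality constraints;
   the leader has m variables. *)
Record lq_game (R : realType) (m N : nat) (n p : 'I_N -> nat) := LQGame {
  lqQ : forall i, 'M[R]_(n i);
  lqE : forall i j, 'M[R]_(n i, n j);
  lqE0 : forall i, 'M[R]_(n i, m);
  lqe : forall i, 'cV[R]_(n i);
  lqC : forall i, 'M[R]_(p i, n i);
  lqd : forall i, 'cV[R]_(p i);
  lqH : forall i, 'M[R]_(p i, m)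
}.

Definition posdefmx (R : realType) (k : nat) (A : 'M[R]_k) : Prop :=
  forall v : 'cV[R]_k, v != 0 -> 0 < dotv v (A *m v).

Notation "''Y[' R ]_ n" := ('cV[R]_(\sum_i n i)%N)
  (at level 8, n at level 2, format "''Y[' R ]_ n") : type_scope.

Definition subst_block (R : realType) (N : nat) (n : 'I_N -> nat) (y : 'Y[R]_n)
    (i : 'I_N) (v : 'cV[R]_(n i)) : 'Y[R]_n :=
  \mxcol_j dfwith (submxcol y) i v j.
Arguments subst_block {R N n} y i v.

Definition follower_cost (R : realType) (m N : nat) (n p : 'I_N -> nat)
    (G : lq_game R m n p) (i : 'I_N) (x : 'cV[R]_m) (y : 'Y[R]_n) : R :=
  2^-1 * dotv (submxcol y i) (lqQ G i *m submxcol y i) +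
  dotv (\sum_j lqE G i j *m submxcol y j + lqE0 G i *m x + lqe G i)
       (submxcol y i).

Definition follower_set (R : realType) (m N : nat) (n p : 'I_N -> nat)
    (G : lq_game R m n p) (i : 'I_N) (x : 'cV[R]_m) : set 'cV[R]_(n i) :=
  [set v | lqC G i *m v = lqd G i + lqH G i *m x].
Arguments follower_set {R m N n p} G i x _.

Definition feasible_set (R : realType) (m N : nat) (n p : 'I_N -> nat)
    (G : lq_game R m n p) (x : 'cV[R]_m) : set 'Y[R]_n :=
  [set y | forall i, follower_set G i x (submxcol y i)].

Definition pseudo_grad (R : realType) (m N : nat) (n p : 'I_N -> nat)
    (G : lq_game R m n p) (x : 'cV[R]_m) (y : 'Y[R]_n) : 'Y[R]_n :=
  \mxcol_i grad (fun v => follower_cost G i x (subst_block y i v)) (submxcol y i).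

Definition VI_solution (R : realType) (k : nat) (F : 'cV[R]_k -> 'cV[R]_k)
    (K : set 'cV[R]_k) (y : 'cV[R]_k) : Prop :=
  K y /\ forall z, K z -> 0 <= dotv (F y) (z - y).

Definition ystar (R : realType) (m N : nat) (n p : 'I_N -> nat)
    (G : lq_game R m n p) (x : 'cV[R]_m) : 'Y[R]_n :=
  xget 0 [set y | VI_solution (pseudo_grad G x) (feasible_set G x) y].

Definition phi_e (R : realType) (m N : nat) (n p : 'I_N -> nat)
    (G : lq_game R m n p) (phi : 'cV[R]_m * 'Y[R]_n -> R) (x : 'cV[R]_m) : R :=
  phi (x, ystar G x).

Definition hmap (R : realType) (m N : nat) (n p : 'I_N -> nat)
    (G : lq_game R m n p) (gamma : R) (x : 'cV[R]_m) (y : 'Y[R]_n) : 'Y[R]_n :=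
  eproj (feasible_set G x) (y - gamma *: pseudo_grad G x y).

(* hmap is affine, so its partial Jacobians may be taken at the origin. *)
Definition J1h (R : realType) (m N : nat) (n p : 'I_N -> nat)
    (G : lq_game R m n p) (gamma : R) : 'M[R]_((\sum_i n i)%N, m) :=
  jac (fun x => hmap G gamma x 0) 0.

Definition J2h (R : realType) (m N : nat) (n p : 'I_N -> nat)
    (G : lq_game R m n p) (gamma : R) : 'M[R]_((\sum_i n i)%N) :=
  jac (fun y => hmap G gamma 0 y) 0.

Definition hypergrad (R : realType) (p q : nat) (phi : 'cV[R]_p * 'cV[R]_q -> R)
    (x : 'cV[R]_p) (y : 'cV[R]_q) (s : 'M[R]_(q, p)) : 'cV[R]_p :=
  grad1 phi (x, y) + s^T *m grad2 phi (x, y).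

Record single_loop_big_hype (R : realType) (m N : nat) (n p : 'I_N -> nat)
    (G : lq_game R m n p) (phi : 'cV[R]_m * 'Y[R]_n -> R) (X : set 'cV[R]_m)
    (gamma : R) (alpha beta : nat -> R) (x : nat -> 'cV[R]_m)
    (y : nat -> 'Y[R]_n) (s : nat -> 'M[R]_((\sum_i n i)%N, m)) : Prop := {
  big_hype_x : forall k, x k.+1 = x k + beta k *:
    (eproj X (x k - alpha k *: hypergrad phi (x k) (y k) (s k)) - x k);
  big_hype_y : forall k, y k.+1 = hmap G gamma (x k.+1) (y k);
  big_hype_s : forall k, s k.+1 = J2h G gamma *m s k + J1h G gamma
}.

Definition linear_rate (R : realType) (delta : nat -> R) : Prop :=
  exists C rho : R, [/\ 0 < C, 0 < rho < 1 & forall k, delta k <= C * rho ^+ k].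

(* Main.v *)
(** Each feasible set is affine and cut out by a full-row-rank matrix, so its
    projection is affine, h(x, y) = J2 y + J1 x + h0, and h(x, .) contracts with
    factor eta = sqrt(1 - 2 gamma mu + gamma^2 LF^2) < 1.  Hence I - J2 is
    invertible, y*(x) = W x + w with W = (I - J2)^-1 J1, and |s^k - W| = O(eta^k).

    Strong convexity of phi passes to phi_e through the affine map x |-> (x, y*(x)),
    and with alpha L <= 1 the projected gradient map T of phi_e satisfies
    <x - T x, x - x*> >= (alpha sigma / 2) |x - x*|^2.  As |T x - x| <= 3 |x - x*|,
    the relaxed step x + beta (T x - x) contracts towards x* with factor
    1 - beta alpha sigma / 4 for small beta.

    Write a = |x^k - x*|, e = |y^k - y*(x^k)| and delta = |s^k - W|.  The hypergradient
    error is O(e + delta (1 + a + e)), so for a suitable weight lam and all small beta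
    the quantity V = a + lam e obeys V' <= r V + D eta^k (1 + V) with r < 1; V
    therefore decays geometrically.  The threshold on beta must not depend on s^0,
    which is why delta is kept as a decaying multiplicative perturbation instead of
    being bounded. *)
Require Import Defs.
From mathcomp Require Import all_boot all_order all_algebra.
From mathcomp Require Import all_classical all_reals all_analysis.
From mathcomp Require Import ring lra.

Set Implicit Arguments.
Unset Strict Implicit.
Unset Printing Implicit Defensive.

Import Order.TTheory GRing.Theory Num.Theory.
Import numFieldNormedType.Exports.

Local Open Scope classical_set_scope.
Local Open Scope ring_scope.

(** * Frobenius inner product and Euclidean norm *)

Section FrobeniusInnerProduct.
Variable R : realType.

(** One inner product serves both the vector iterates and the matrix iterate s; as a trace, moving a
    factor to the other side is mere associativity. *)
Definition dotm p q (A B : 'M[R]_(p, q)) : R := \tr (A^T *m B).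

Section Dotm.
Variables p q : nat.
Implicit Types A B C : 'M[R]_(p, q).

Lemma dotmE A B : dotm A B = \sum_i \sum_j A i j * B i j.
Proof.
rewrite /dotm /mxtrace exchange_big; apply: eq_bigr => j _.
by rewrite mxE; apply: eq_bigr => i _; rewrite mxE.
Qed.

Lemma dotmC A B : dotm A B = dotm B A.
Proof. by rewrite /dotm -mxtrace_tr trmx_mul trmxK. Qed.

Lemma dotmDl A B C : dotm (A + B) C = dotm A C + dotm B C.
Proof. by rewrite /dotm linearD mulmxDl mxtraceD. Qed.

Lemma dotmDr A B C : dotm A (B + C) = dotm A B + dotm A C.
Proof. by rewrite /dotm mulmxDr mxtraceD. Qed.

Lemma dotmZl a A B : dotm (a *: A) B = a * dotm A B.
Proof. by rewrite /dotm linearZ -scalemxAl mxtraceZ. Qed.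

Lemma dotmZr a A B : dotm A (a *: B) = a * dotm A B.
Proof. by rewrite /dotm -scalemxAr mxtraceZ. Qed.

Lemma dotmNl A B : dotm (- A) B = - dotm A B.
Proof. by rewrite -scaleN1r dotmZl mulN1r. Qed.

Lemma dotmNr A B : dotm A (- B) = - dotm A B.
Proof. by rewrite -scaleN1r dotmZr mulN1r. Qed.

Lemma dotm0l A : dotm 0 A = 0.
Proof. by rewrite -(scale0r A) dotmZl mul0r. Qed.

Lemma dotm0r A : dotm A 0 = 0.
Proof. by rewrite dotmC dotm0l. Qed.

Definition dotm_lin := (dotmDl, dotmDr, dotmZl, dotmZr, dotmNl, dotmNr).

Lemma dotm_ge0 A : 0 <= dotm A A.
Proof.
by rewrite dotmE; do 2! apply: sumr_ge0 => ? _; rewrite -expr2 sqr_ge0.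
Qed.

Lemma dotm_eq0 A : dotm A A = 0 -> A = 0.
Proof.
rewrite dotmE => A0; apply/matrixP => i j; rewrite mxE.
have row_ge0 k : 0 <= \sum_l A k l * A k l.
  by apply: sumr_ge0 => ? _; rewrite -expr2 sqr_ge0.
have /(_ i isT)/eqP row0 := psumr_eq0P (fun k _ => row_ge0 k) A0.
have /(_ j isT)/eqP := psumr_eq0P (fun l _ => sqr_ge0 (A i l)) (eqP row0).
by rewrite sqrf_eq0 => /eqP.
Qed.

Lemma enorm_ge0 A : 0 <= enorm A.
Proof. exact: sqrtr_ge0. Qed.

Lemma sqr_enorm A : enorm A ^+ 2 = dotm A A.
Proof.
have -> : dotm A A = \sum_i \sum_j A i j ^+ 2.
  by rewrite dotmE; do 2! apply: eq_bigr => ? _; rewrite expr2.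
by rewrite sqr_sqrtr //; do 2! apply: sumr_ge0 => ? _; rewrite sqr_ge0.
Qed.

Lemma enorm_eq0 A : enorm A = 0 -> A = 0.
Proof. by move=> A0; apply: dotm_eq0; rewrite -sqr_enorm A0 expr0n. Qed.

Lemma enorm_le A B : (enorm A <= enorm B) = (dotm A A <= dotm B B).
Proof. by rewrite -!sqr_enorm ler_pXn2r // nnegrE enorm_ge0. Qed.

Lemma enorm_leP A c : 0 <= c -> dotm A A <= c ^+ 2 -> enorm A <= c.
Proof. by move=> c0; rewrite -sqr_enorm ler_pXn2r // nnegrE enorm_ge0. Qed.

(** Cauchy-Schwarz: the squared norm of <B,B> A - <A,B> B equals <B,B> (<A,A> <B,B> - <A,B>^2). *)
Lemma sqr_dotm_le A B : dotm A B ^+ 2 <= dotm A A * dotm B B.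
Proof.
have [B0|B0] := eqVneq (dotm B B) 0.
  by rewrite (dotm_eq0 B0) !dotm0r expr0n mulr0.
have Bgt0 : 0 < dotm B B by rewrite lt_def B0 dotm_ge0.
have := dotm_ge0 (dotm B B *: A - dotm A B *: B).
rewrite !dotm_lin (dotmC B A) => ge0.
rewrite -subr_ge0 -(pmulr_rge0 _ Bgt0); congr (0 <= _): ge0; ring.
Qed.

Lemma dotm_le A B : dotm A B <= enorm A * enorm B.
Proof.
have AB0 : 0 <= enorm A * enorm B by rewrite mulr_ge0 ?enorm_ge0.
have [neg|pos] := leP (dotm A B) 0; first exact: le_trans neg AB0.
rewrite -ler_sqr ?nnegrE //; last exact: ltW.
by rewrite exprMn !sqr_enorm sqr_dotm_le.
Qed.

Lemma enormZ a A : enorm (a *: A) = `|a| * enorm A.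
Proof.
apply/eqP; rewrite -(@eqrXn2 _ 2) ?mulr_ge0 ?enorm_ge0 //.
by rewrite exprMn !sqr_enorm real_normK ?num_real // !dotm_lin mulrA expr2.
Qed.

Lemma enormN A : enorm (- A) = enorm A.
Proof. by rewrite -scaleN1r enormZ normrN1 mul1r. Qed.

Lemma enormD A B : enorm (A + B) <= enorm A + enorm B.
Proof.
apply: enorm_leP; first by rewrite addr_ge0 ?enorm_ge0.
rewrite sqrrD !sqr_enorm !dotm_lin (dotmC B A).
have := dotm_le A B; lra.
Qed.

Lemma enormB A B : enorm (A - B) <= enorm A + enorm B.
Proof. by rewrite (le_trans (enormD _ _)) // enormN. Qed.

Lemma enorm_distC A B : enorm (A - B) = enorm (B - A).
Proof. by rewrite -enormN opprB. Qed.

Lemma enorm0 : enorm (0 : 'M[R]_(p, q)) = 0.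
Proof. by rewrite -(scale0r 0) enormZ normr0 mul0r. Qed.

End Dotm.

Lemma dotvE p (u v : 'cV[R]_p) : dotv u v = dotm u v.
Proof. by rewrite /dotv /dotm [u^T *m v]mx11_scalar mxtrace_scalar mxE. Qed.

Lemma dotm_mull p q r (A : 'M[R]_(p, q)) (B : 'M[R]_(q, r)) C :
  dotm (A *m B) C = dotm B (A^T *m C).
Proof. by rewrite /dotm trmx_mul mulmxA. Qed.

Lemma dotm_mulr p q r (A : 'M[R]_(p, q)) (B : 'M[R]_(q, r)) C :
  dotm C (A *m B) = dotm (A^T *m C) B.
Proof. by rewrite dotmC dotm_mull dotmC. Qed.

Lemma enorm_tr p q (A : 'M[R]_(p, q)) : enorm A^T = enorm A.
Proof.
rewrite /enorm exchange_big; congr Num.sqrt.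
by do 2! apply: eq_bigr => ? _; rewrite mxE.
Qed.

Lemma dotm_cols p q (A B : 'M[R]_(p, q)) :
  dotm A B = \sum_j dotm (col j A) (col j B).
Proof.
rewrite dotmE exchange_big; apply: eq_bigr => j _; rewrite dotmE.
by apply: eq_bigr => i _; rewrite big_ord1 !mxE.
Qed.

(** The squared Frobenius norm sums over columns, so a bound on vectors carries over to matrices.
    This transfers the contraction of [J2h] to the recursion for s. *)
Lemma enorm_mulmx_le p q r (A : 'M[R]_(p, q)) c : 0 <= c ->
  (forall v : 'cV[R]_q, enorm (A *m v) <= c * enorm v) ->
  forall B : 'M[R]_(q, r), enorm (A *m B) <= c * enorm B.
Proof.
move=> c0 Ac B; apply: enorm_leP; first by rewrite mulr_ge0 ?enorm_ge0.
rewrite exprMn sqr_enorm !dotm_cols mulr_sumr; apply: ler_sum => j _.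
rewrite !colE -mulmxA -!sqr_enorm -exprMn.
by rewrite ler_pXn2r ?nnegrE ?mulr_ge0 ?enorm_ge0.
Qed.

Lemma enormM p q r (A : 'M[R]_(p, q)) (B : 'M[R]_(q, r)) :
  enorm (A *m B) <= enorm A * enorm B.
Proof.
apply: enorm_mulmx_le (enorm_ge0 _) _ _ => v.
(* After transposing, the columns of v^T A^T are the inner products of v with the rows of A, and
   Cauchy-Schwarz applies to each. *)
rewrite mulrC -[enorm A]enorm_tr -[enorm (A *m v)]enorm_tr trmx_mul.
apply: enorm_leP; first by rewrite mulr_ge0 ?enorm_ge0.
rewrite exprMn !sqr_enorm dotm_cols [dotm A^T A^T]dotm_cols mulr_sumr.
apply: ler_sum => i _.
set a := col i A^T.
have -> : col i (v^T *m A^T) = (dotm v a)%:M.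
  by rewrite /a !colE -mulmxA -!colE -/a [v^T *m a]mx11_scalar -dotvE.
rewrite /dotm tr_scalar_mx -scalar_mxM mxtrace_scalar mulr1n -expr2.
exact: sqr_dotm_le.
Qed.

Lemma sqr_enorm2 p q (z : 'cV[R]_p * 'cV[R]_q) :
  enorm2 z ^+ 2 = enorm z.1 ^+ 2 + enorm z.2 ^+ 2.
Proof. by rewrite sqr_sqrtr // addr_ge0 ?sqr_ge0. Qed.

Lemma enorm2_le p q (z : 'cV[R]_p * 'cV[R]_q) :
  enorm2 z <= enorm z.1 + enorm z.2.
Proof.
have ? := enorm_ge0 z.1; have ? := enorm_ge0 z.2.
rewrite -ler_sqr ?nnegrE ?sqrtr_ge0 ?addr_ge0 // sqr_enorm2 sqrrD.
by rewrite lerD2r lerDl mulrn_wge0 // mulr_ge0.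
Qed.

End FrobeniusInnerProduct.

(** * Projections and directional derivatives *)

Section EuclideanProjection.
Variables (R : realType) (p : nat).
Implicit Types (K : set 'cV[R]_p) (z u v : 'cV[R]_p).

(** The obtuse-angle form of the Euclidean projection, in which variational inequalities can be read
    off directly. *)
Definition proj_point K z u :=
  K u /\ forall v, K v -> dotm (z - u) (v - u) <= 0.

(** Adding the two angle inequalities gives |u - u'|^2 <= <z - z', u - u'>; expanding |(z - z') - (u
    - u')|^2 >= 0 finishes. *)
Lemma proj_point_lip K z z' u u' :
  proj_point K z u -> proj_point K z' u' -> enorm (u - u') <= enorm (z - z').
Proof.
move=> [Ku /(_ u') hu] [Ku' /(_ u Ku) hu']; have {}hu := hu Ku'.
rewrite enorm_le; have := dotm_ge0 (z - z' - (u - u')).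
move: hu hu'; rewrite !dotm_lin.
rewrite (dotmC u z) (dotmC u z') (dotmC u' z) (dotmC u' z') (dotmC z' z).
by rewrite (dotmC u' u) => ? ? ?; lra.
Qed.

(** The angle condition yields |z - u|^2 + |v - u|^2 <= |z - v|^2 on K, so u is a nearest point and
    any other nearest point equals it. *)
Lemma eproj_unique K z u : proj_point K z u -> eproj K z = u.
Proof.
move=> [Ku hu].
have pyth v : K v -> dotm (z - u) (z - u) + dotm (v - u) (v - u) <=
                     dotm (z - v) (z - v).
  move=> /hu; rewrite !dotm_lin (dotmC u z) (dotmC v z) (dotmC v u) => ?; lra.
apply: xget_unique => [|v [Kv minv]].
  split=> // v /pyth uv; rewrite enorm_le; apply: le_trans uv.
  by rewrite lerDl dotm_ge0.
have := minv u Ku; rewrite -ler_sqr ?nnegrE ?enorm_ge0 // !sqr_enorm => le_vu.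
apply/eqP; rewrite -subr_eq0; apply/eqP/dotm_eq0/eqP.
by rewrite eq_le dotm_ge0 andbT; have := pyth v Kv; lra.
Qed.

Lemma convex_setP K : convex_set K ->
  forall u v t, K u -> K v -> 0 <= t <= 1 -> K (u + t *: (v - u)).
Proof.
move=> cK u v t Ku Kv /andP[t0 t1].
have := cK v u (Itv01 t0 t1); rewrite !inE => /(_ Kv Ku).
rewrite [conv _ _ _](_ : _ = u + t *: (v - u)) // /conv /=.
by rewrite scalerBr scalerBl scale1r addrCA.
Qed.

Lemma enorm_continuous : continuous (@enorm R p 1).
Proof.
move=> u; apply: continuous_comp; last exact: sqrt_continuous.
have addC : continuous (fun x : R * R => x.1 + x.2) by exact: add_continuous.
move: u; apply: (continuous_big addC) => i _.
apply: (continuous_big addC) => j _ u.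
apply: (@continuous_comp _ _ _ (fun M : 'cV[R]_p => M i j) (fun x => x ^+ 2)).
  exact: coord_continuous.
exact: exprn_continuous.
Qed.

Lemma proj_point_eproj K z : K !=set0 -> convex_set K -> compact K ->
  proj_point K z (eproj K z).
Proof.
move=> K0 cK compK; set P := is_minimizer K (fun v => enorm (z - v)).
have : P (eproj K z).
  apply: xgetPex.
  have contz : continuous (fun v => enorm (z - v)).
    move=> v; apply: (@continuous_comp _ _ _ (fun v => z - v) (@enorm R p 1)).
      by apply: continuousB; [exact: cst_continuous|move=> ?].
    exact: enorm_continuous.
  have := compact_EVT_min K0 compK (continuous_subspaceT contz).
  move=> [u].
  rewrite inE => Ku minu; exists u; split=> // v Kv.
  by apply: minu; rewrite inE.
set u := eproj K z => -[Ku minu]; split=> // v Kv; rewrite leNgt; apply/negP.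
set a := dotm _ _ => a_gt0; set b := dotm (v - u) (v - u).
have b0 : 0 <= b by exact: dotm_ge0.
(* Compare u with the point u + t (v - u) of K. *)
have key t : 0 <= t <= 1 -> 2 * t * a <= t ^+ 2 * b.
  move=> t01; have := minu _ (convex_setP cK Ku Kv t01).
  rewrite enorm_le opprD addrA.
  rewrite (dotmDl (z - u)) (dotmDr (z - u) (z - u)) (dotmDr _ (z - u)).
  rewrite !(dotmNl, dotmNr, dotmZl, dotmZr) (dotmC (v - u) (z - u)).
  by rewrite -/a -/b => ?; lra.
have ab0 : 0 < a + b by lra.
(* This t is admissible even if b = 0, and 2ta - t^2 b = a^2 (2a + b) / (a + b)^2 > 0 contradicts
   [key]. *)
have t01 : 0 <= a / (a + b) <= 1.
  by rewrite divr_ge0 ?(ltW a_gt0) ?(ltW ab0) //= ler_pdivrMr // mul1r lerDl.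
have := key _ t01; apply/negP; rewrite -ltNge.
rewrite -(ltr_pM2r (exprn_gt0 2 ab0)) -subr_gt0.
rewrite [ltRHS](_ : _ = a ^+ 2 * (2 * a + b)); first by rewrite mulr_gt0 ?exprn_gt0 //; lra.
by field; lra.
Qed.

End EuclideanProjection.

Section DirectionalDerivatives.
Variables (R : realType) (V : normedModType R).

Lemma affine_cvg0 (c k : R) : (fun t => c + t * k) @ 0 --> c.
Proof.
rewrite -[X in _ --> X]addr0 -[X in _ --> _ + X](mul0r k).
apply: cvgD; first exact: cvg_cst.
by apply: cvgM; [exact: cvg_id|exact: cvg_cst].
Qed.

(** The bound on difference quotients passes to the limit from the right; [k] absorbs a second-order
    term. *)
Lemma derive_le (f : V -> R) a v c k : derivable f a v ->
  (forall t, 0 < t <= 1 -> f (t *: v + a) - f a <= t * (c + t * k)) ->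
  'D_v f a <= c.
Proof.
move=> /cvg_dnbhs_at_right df fle.
have cvgk : (fun t : R => c + t * k) @ 0^'+ --> c.
  exact/cvg_at_right_filter/affine_cvg0.
apply: (ler_cvg_to df cvgk); near=> t.
have t_gt0 : 0 < t by near: t; exact: nbhs_right_gt.
rewrite /= /GRing.scale /= mulrC ler_pdivrMr // mulrC; apply: fle.
by rewrite t_gt0 /=; near: t; exact: nbhs_right_le.
Unshelve. all: by end_near. Qed.

Lemma derive_quadratic (f : V -> R) a v c k :
  (forall t, f (t *: v + a) - f a = t * (c + t * k)) -> 'D_v f a = c.
Proof.
move=> fE; apply: cvg_lim => //.
apply: (@cvg_trans _ ((fun t : R => c + t * k) @ 0^')).
  apply: near_eq_cvg; near=> t.
  have t0 : t != 0 by near: t; exact: nbhs_dnbhs_neq.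
  by rewrite /= fE /GRing.scale /= mulKf.
apply: cvg_within_filter; exact: affine_cvg0.
Unshelve. all: by end_near. Qed.

End DirectionalDerivatives.

(** A directional derivative sees only the restriction to a line, so functions on different spaces
    can be compared. *)
Lemma eq_derive (R : realType) (V W : normedModType R) (f : V -> R)
    (g : W -> R) a v b w :
  (forall t : R, f (t *: v + a) = g (t *: w + b)) -> 'D_v f a = 'D_w g b.
Proof.
move=> fg; rewrite /derive; have fgab : f a = g b.
  by have := fg 0; rewrite !scale0r !add0r.
rewrite (_ : (fun h : R => _) =
             (fun h : R => h^-1 *: ((g \o shift b) (h *: w) - g b))) //.
by apply/funext => h; rewrite /= fg fgab.
Qed.

Lemma scale_pairD (R : pzRingType) (U V : lmodType R) (t : R) (u a : U)
    (v b : V) : t *: (u, v) + (a, b) = (t *: u + a, t *: v + b).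
Proof. by []. Qed.

Lemma cV_sum_delta (R : pzRingType) p (v : 'cV[R]_p) :
  v = \sum_k v k 0 *: delta_mx k 0.
Proof.
by rewrite {1}(matrix_sum_delta v); apply: eq_bigr => k _; rewrite big_ord1.
Qed.

Lemma dotm_delta (R : realType) p (g : 'cV[R]_p) k :
  dotm g (delta_mx k 0) = g k 0.
Proof.
rewrite dotmC dotmE (bigD1 k) //= big_ord1 mxE !eqxx mul1r big1 ?addr0 //.
by move=> i ik; rewrite big_ord1 mxE (negPf ik) mul0r.
Qed.

(** * Partial gradients: chain rule and first-order strong convexity *)

Section PartialGradients.
Variables (R : realType) (p q : nat) (phi : 'cV[R]_p * 'cV[R]_q -> R).
Hypothesis phi_diff : forall z, differentiable phi z.

(** Differentiability makes the derivative linear in its direction, so it can be expanded over the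
    coordinate directions that define the partial gradients. *)
Lemma derive_pairE z u v :
  'D_(u, v) phi z = dotm (grad1 phi z) u + dotm (grad2 phi z) v.
Proof.
have DD e e' : 'D_(e + e') phi z = 'D_e phi z + 'D_e' phi z.
  by rewrite !deriveE // linearD.
have DZ t e : 'D_(t *: e) phi z = t * 'D_e phi z.
  by rewrite !deriveE // linearZ.
have Dsum (n : nat) (F : 'I_n -> 'cV[R]_p * 'cV[R]_q) :
    'D_(\sum_k F k) phi z = \sum_k 'D_(F k) phi z.
  exact: (big_morph (fun e => 'D_e phi z) DD (derive0 _ _)).
have g1 k : grad1 phi z k 0 = 'D_(delta_mx k 0, 0) phi z.
  rewrite mxE; apply: eq_derive => t.
  by case: z {DD DZ Dsum} => z1 z2; rewrite scale_pairD scaler0 add0r.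
have g2 k : grad2 phi z k 0 = 'D_(0, delta_mx k 0) phi z.
  rewrite mxE; apply: eq_derive => t.
  by case: z {DD DZ Dsum g1} => z1 z2; rewrite scale_pairD scaler0 add0r.
have sum1 : (u, 0 : 'cV[R]_q) = \sum_k u k 0 *: (delta_mx k 0, 0).
  rewrite [LHS]surjective_pairing [RHS]surjective_pairing.
  rewrite !(raddf_sum fst) !(raddf_sum snd) /=.
  by rewrite -cV_sum_delta big1 // => k _; rewrite scaler0.
have sum2 : (0 : 'cV[R]_p, v) = \sum_k v k 0 *: (0, delta_mx k 0).
  rewrite [LHS]surjective_pairing [RHS]surjective_pairing.
  rewrite !(raddf_sum fst) !(raddf_sum snd) /=.
  by rewrite -cV_sum_delta big1 // => k _; rewrite scaler0.
have -> : (u, v) = (u, 0) + (0, v).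
  by rewrite [RHS]surjective_pairing /= addr0 add0r.
rewrite DD sum1 sum2 !Dsum !dotmE; congr (_ + _); apply: eq_bigr => k _.
  by rewrite big_ord1 DZ g1 mulrC.
by rewrite big_ord1 DZ g2 mulrC.
Qed.

(** The graph map sends a line of direction e_k to one of direction (e_k, W e_k). This identifies
    the gradient of [phi_e] with the hypergradient at the exact equilibrium and sensitivity. *)
Lemma grad_affine_comp (W : 'M[R]_(q, p)) w x :
  grad (fun u => phi (u, W *m u + w)) x =
  grad1 phi (x, W *m x + w) + W^T *m grad2 phi (x, W *m x + w).
Proof.
apply/colP => k; rewrite mxE.
have -> : 'D_(delta_mx k 0) (fun u => phi (u, W *m u + w)) x =
          'D_(delta_mx k 0, W *m delta_mx k 0) phi (x, W *m x + w).
  by apply: eq_derive => t; rewrite scale_pairD mulmxDr -scalemxAr addrA.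
by rewrite derive_pairE dotm_mulr !dotm_delta [RHS]mxE.
Qed.

Lemma strongly_convex_first_order sigma : strongly_convex2 sigma phi ->
  forall z u v,
    phi z + (dotm (grad1 phi z) u + dotm (grad2 phi z) v) +
      sigma / 2 * enorm2 (u, v) ^+ 2 <= phi (z + (u, v)).
Proof.
move=> phi_sc z u v; rewrite -derive_pairE -lerBrDr -lerBrDl.
(* In sigma/2 t (1 - t) |(u, v)|^2 the part linear in t stays in the bound; the t^2 part is the
   supplied constant. *)
apply: (@derive_le _ _ _ _ _ _ (sigma / 2 * enorm2 (u, v) ^+ 2)).
  exact: diff_derivable.
move=> t /andP[t0 t1]; have := phi_sc t (z + (u, v)) z; rewrite (ltW t0) t1.
have -> : t *: (z + (u, v)) + (1 - t) *: z = t *: (u, v) + z.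
  by rewrite scalerDr scalerBl scale1r addrC subrKA addrC.
have -> : z + (u, v) - z = (u, v) by rewrite addrAC subrr add0r.
move=> /(_ isT); set E := enorm2 _ ^+ 2; lra.
Qed.

End PartialGradients.

(** * The followers' equilibrium *)

Lemma jac_affine (R : realType) p q (M : 'M[R]_(q, p)) b u :
  jac (fun v => M *m v + b) u = M.
Proof.
apply/matrixP => i j; rewrite mxE; apply: (@derive_quadratic _ _ _ _ _ _ 0).
move=> t; rewrite mulmxDr -scalemxAr !mxE mulr0 addr0.
rewrite (bigD1 j) //= !mxE !eqxx mulr1 big1; first by ring.
by move=> k kj; rewrite mxE (negPf kj) mulr0.
Qed.

(** * Projection data for a linear system of full row rank *)

Section AffineConstraint.
Variables (R : realType) (p q : nat) (C : 'M[R]_(p, q)).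
Hypothesis C_free : row_free C.

(** If v C C^T = 0 then |C^T v^T|^2 = 0, and full row rank forces v = 0. *)
Lemma row_free_gram : C *m C^T \in unitmx.
Proof.
rewrite -row_free_unit; apply/inj_row_free => v vCC0.
have CCv0 : C *m (C^T *m v^T) = 0.
  by apply: trmx_inj; rewrite !trmx_mul !trmxK -mulmxA vCC0 trmx0.
apply/eqP; rewrite -(mulmx_free_eq0 _ C_free) -trmx_eq0 trmx_mul.
by apply/eqP/dotm_eq0; rewrite dotm_mull trmxK CCv0 dotm0r.
Qed.

(** The Moore-Penrose inverse K of C: z - K (C z - b) is the projection of z onto {u : C u = b},
    since the range of K is orthogonal to the kernel of C. *)
Definition affine_right_inv : 'M[R]_(q, p) := C^T *m invmx (C *m C^T).

Lemma mul_affine_right_inv : C *m affine_right_inv = 1%:M.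
Proof. by rewrite mulmxA mulmxV // row_free_gram. Qed.

Lemma affine_right_inv_orth w (v : 'cV[R]_q) : C *m v = 0 ->
  dotm (affine_right_inv *m w) v = 0.
Proof. by move=> Cv0; rewrite -mulmxA dotm_mull trmxK Cv0 dotm0r. Qed.

End AffineConstraint.

Lemma dotm_submxcol (R : realType) N (n : 'I_N -> nat) (u v : 'Y[R]_n) :
  dotm u v = \sum_i dotm (submxcol u i) (submxcol v i).
Proof.
rewrite -{1}(submxcolK u) -{1}(submxcolK v) /dotm tr_mxcol mul_mxrow_mxcol.
by rewrite raddf_sum.
Qed.

(** * Affine formulas for the pseudo-gradient and the feasible projection *)

Section LinearQuadraticGame.
Variables (R : realType) (m N : nat) (n p : 'I_N -> nat) (G : lq_game R m n p).

Lemma submxcol_subst_block (y : 'Y[R]_n) i v j :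
  submxcol (subst_block y i v) j = dfwith (submxcol y) i v j.
Proof. by rewrite mxcolK. Qed.

(** The linear term of the cost contains E_{i,i} y_i and so is itself quadratic in y_i; its gradient
    gives E_{i,i}^T y_i besides the E_{i,i} y_i inside the sum. *)
Definition pseudo_grad_block i (x : 'cV[R]_m) (y : 'Y[R]_n) : 'cV[R]_(n i) :=
  (2^-1 *: (lqQ G i + (lqQ G i)^T) + (lqE G i i)^T) *m submxcol y i +
  (\sum_j lqE G i j *m submxcol y j + lqE0 G i *m x + lqe G i).

Lemma pseudo_gradE x y : pseudo_grad G x y = \mxcol_i pseudo_grad_block i x y.
Proof.
apply/eq_mxcol => i; apply/colP => k; rewrite mxE -dotm_delta.
set d := delta_mx k 0; set v0 := submxcol y i; set E := lqE G i i.
(* Everything in the linear term that stays fixed when block i varies. *)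
set b := \sum_(j | j != i) lqE G i j *m submxcol y j + lqE0 G i *m x + lqe G i.
have costE v : follower_cost G i x (subst_block y i v) =
    2^-1 * dotm v (lqQ G i *m v) + dotm (E *m v + b) v.
  rewrite /follower_cost !dotvE submxcol_subst_block dfwithin; congr (_ + dotm _ _).
  rewrite (bigD1 i) //= submxcol_subst_block dfwithin /b -!addrA.
  congr (_ + (_ + _)); apply: eq_bigr => j ji.
  by rewrite submxcol_subst_block dfwithout // eq_sym.
have -> : pseudo_grad_block i x y =
    (2^-1 *: (lqQ G i + (lqQ G i)^T) + E^T) *m v0 + (E *m v0 + b).
  by rewrite /pseudo_grad_block (bigD1 i) //= /b -!addrA.
(* The supplied constant is the coefficient of t^2 in the cost along direction d. *)
clearbody b; apply: (@derive_quadratic _ _ _ _ _ _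
  (2^-1 * dotm d (lqQ G i *m d) + dotm (E *m d) d)) => t.
rewrite !costE !mulmxDr !mulmxDl -!scalemxAr -!scalemxAl !mulmxDl !dotm_lin.
rewrite (dotmC d (_ *m v0)) (dotm_mulr _ d v0) (dotm_mull E d v0).
by rewrite (dotmC d (_ *m v0)); field.
Qed.

Lemma pseudo_grad_affine : exists A B c, forall x y,
  pseudo_grad G x y = A *m y + B *m x + c.
Proof.
exists (\mxdiag_i (2^-1 *: (lqQ G i + (lqQ G i)^T) + (lqE G i i)^T) +
        \mxblock_(i, j) lqE G i j), (\mxcol_i lqE0 G i), (\mxcol_i lqe G i).
move=> x y; rewrite pseudo_gradE mulmxDl -{2 3}(submxcolK y).
rewrite mul_mxdiag_mxcol mxblockEv !mxcol_mul -!mxcolD; apply/eq_mxcol => i.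
by rewrite mul_mxrow_mxcol /pseudo_grad_block !addrA.
Qed.

Hypothesis C_free : forall i, row_free (lqC G i).

(** Block i is z_i - K_i (C_i z_i - d_i - H_i x) with K_i the right inverse above. The residual is
    orthogonal to differences of feasible points, so the angle condition holds with equality; x
    enters only through the right-hand side. *)
Lemma eproj_feasible : exists P K k, forall x z,
  let u := P *m z + (K *m x + k) in
  eproj (feasible_set G x) z = u /\
  feasible_set G x u /\ forall v, feasible_set G x v -> dotm (z - u) (v - u) = 0.
Proof.
pose K i := affine_right_inv (lqC G i).
exists (\mxdiag_i (1%:M - K i *m lqC G i)), (\mxcol_i (K i *m lqH G i)),
  (\mxcol_i (K i *m lqd G i)) => x z; set u := _ + _.
have uE i : submxcol u i =
    submxcol z i - K i *m (lqC G i *m submxcol z i - (lqd G i + lqH G i *m x)).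
  rewrite /u -{1}(submxcolK z) mul_mxdiag_mxcol mxcol_mul -!mxcolD mxcolK.
  rewrite mulmxBl mul1mx -(mulmxA (K i) (lqC G i)) -(mulmxA (K i) (lqH G i)).
  rewrite mulmxBr opprB mulmxDr -!addrA; congr (_ + _).
  by rewrite addrC [RHS]addrA; congr (_ + _); rewrite addrC.
have feas_u : feasible_set G x u.
  move=> i; rewrite /follower_set /= uE mulmxBr mulmxA mul_affine_right_inv //.
  by rewrite mul1mx opprB addrC subrK.
have orth v : feasible_set G x v -> dotm (z - u) (v - u) = 0.
  move=> feas_v; rewrite dotm_submxcol big1 // => i _.
  rewrite submxcolB [in submxcol u i]uE opprB addrC subrK.
  apply: affine_right_inv_orth; rewrite submxcolB mulmxBr.
  by rewrite (feas_v i) (feas_u i) subrr.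
split=> //; apply: eproj_unique; split=> // v /orth ->.
by rewrite lexx.
Qed.

End LinearQuadraticGame.

(** * Contraction of the followers' map and the affine equilibrium *)

Section Equilibrium.
Variables (R : realType) (m N : nat) (n p : 'I_N -> nat) (G : lq_game R m n p).
Hypothesis C_free : forall i, row_free (lqC G i).
Variables mu LF gamma : R.
Hypothesis mu_gt0 : 0 < mu.
Hypothesis Fmono : forall (x : 'cV[R]_m) (y y' : 'Y[R]_n),
  mu * enorm (y - y') ^+ 2 <=
  dotv (pseudo_grad G x y - pseudo_grad G x y') (y - y').
Hypothesis Flip : forall (x : 'cV[R]_m) (y y' : 'Y[R]_n),
  enorm (pseudo_grad G x y - pseudo_grad G x y') <= LF * enorm (y - y').
Hypothesis gamma_bounds : 0 < gamma < 2 * mu / LF ^+ 2.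

Definition hmap_lip : R := Num.sqrt (1 - 2 * gamma * mu + gamma ^+ 2 * LF ^+ 2).

Lemma hmap_lip_lt1 : hmap_lip < 1.
Proof.
have /andP[g0 gLF] := gamma_bounds.
(* Division by zero returns 0, so LF = 0 would leave no room for a positive gamma. *)
have LF2 : 0 < LF ^+ 2.
  rewrite lt_def sqr_ge0 andbT; apply: contraTneq gLF => ->.
  by rewrite invr0 mulr0 lt_gtF.
move: gLF; rewrite ltr_pdivlMr // => gLF.
rewrite -sqrtr1 ltr_sqrt //; have : gamma * (gamma * LF ^+ 2) < gamma * (2 * mu).
  by rewrite ltr_pM2l.
by lra.
Qed.

Lemma proj_point_hmap x y : proj_point (feasible_set G x)
  (y - gamma *: pseudo_grad G x y) (hmap G gamma x y).
Proof.
have [P [K [k /(_ x (y - gamma *: pseudo_grad G x y))[e [feas orth]]]]] :=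
  eproj_feasible C_free.
by rewrite /hmap e; split=> // v /orth ->; rewrite lexx.
Qed.

(** The projection is nonexpansive, so only the forward step matters: |d - gamma f|^2 = |d|^2 - 2
    gamma <f, d> + gamma^2 |f|^2, bounded by monotonicity and Lipschitz continuity. *)
Lemma hmap_contraction x y y' :
  enorm (hmap G gamma x y - hmap G gamma x y') <= hmap_lip * enorm (y - y').
Proof.
apply: le_trans (proj_point_lip (proj_point_hmap x y) (proj_point_hmap x y')) _.
apply: enorm_leP; first by rewrite mulr_ge0 ?enorm_ge0 ?sqrtr_ge0.
set c := 1 - 2 * gamma * mu + gamma ^+ 2 * LF ^+ 2.
(* [Num.sqrt] is 0 on negative arguments, so only this inequality is claimed. *)
have le_c : c <= hmap_lip ^+ 2.
  have [c0|c0] := leP 0 c; first by rewrite sqr_sqrtr.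
  exact: le_trans (ltW c0) (sqr_ge0 _).
rewrite exprMn; apply: le_trans (ler_wpM2r (sqr_ge0 _) le_c).
have /andP[g0 _] := gamma_bounds.
have -> : y - gamma *: pseudo_grad G x y - (y' - gamma *: pseudo_grad G x y') =
          y - y' - gamma *: (pseudo_grad G x y - pseudo_grad G x y').
  by apply/matrixP => i j; rewrite !mxE; ring.
have := Fmono x y y'; rewrite dotvE sqr_enorm.
set d := y - y'; set f := pseudo_grad G x y - pseudo_grad G x y' => mono.
have {}mono : gamma * (mu * dotm d d) <= gamma * dotm f d by rewrite ler_pM2l.
have lip : gamma ^+ 2 * dotm f f <= gamma ^+ 2 * (LF ^+ 2 * dotm d d).
  rewrite ler_pM2l ?exprn_gt0 // -!sqr_enorm -exprMn.
  by rewrite ler_pXn2r ?nnegrE ?enorm_ge0 // ?Flip // (le_trans (enorm_ge0 f)) ?Flip.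
clearbody d f; rewrite !dotm_lin (dotmC d f) /c.
lra.
Qed.

Lemma hmap_affine : exists J2 J1 h0, forall x y,
  hmap G gamma x y = J2 *m y + J1 *m x + h0.
Proof.
have [A [B [c FE]]] := pseudo_grad_affine G.
have [P [K [k PE]]] := eproj_feasible C_free.
exists (P *m (1%:M - gamma *: A)), (K - gamma *: (P *m B)), (k - gamma *: (P *m c)).
move=> x y; rewrite /hmap; have [-> _] := PE x (y - gamma *: pseudo_grad G x y).
rewrite FE !scalerDr !mulmxBr !mulmxDr !mulmxBl mulmx1 -!scalemxAr -!scalemxAl.
by apply/colP => i; rewrite !mulmxA !mxE; ring.
Qed.

Lemma J1hE J2 J1 h0 : (forall x y, hmap G gamma x y = J2 *m y + J1 *m x + h0) ->
  J1h G gamma = J1.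
Proof.
move=> hE; rewrite /J1h.
have -> : (fun x => hmap G gamma x 0) = (fun x => J1 *m x + h0).
  by apply/funext => x; rewrite hE mulmx0 add0r.
exact: jac_affine.
Qed.

Lemma J2hE J2 J1 h0 : (forall x y, hmap G gamma x y = J2 *m y + J1 *m x + h0) ->
  J2h G gamma = J2.
Proof.
move=> hE; rewrite /J2h.
have -> : (fun y => hmap G gamma 0 y) = (fun y => J2 *m y + h0).
  by apply/funext => y; rewrite hE mulmx0 addr0.
exact: jac_affine.
Qed.

Lemma J2h_contraction (v : 'Y[R]_n) :
  enorm (J2h G gamma *m v) <= hmap_lip * enorm v.
Proof.
have [J2 [J1 [h0 hE]]] := hmap_affine; rewrite (J2hE hE).
by have := hmap_contraction 0 v 0; rewrite !hE !(mulmx0, add0r, addr0) addrK subr0.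
Qed.

Lemma hmap_fix_VI x y : hmap G gamma x y = y ->
  VI_solution (pseudo_grad G x) (feasible_set G x) y.
Proof.
move=> hy; have [] := proj_point_hmap x y; rewrite hy => feas le0.
split=> // z /le0; rewrite dotvE addrAC subrr add0r dotmNl dotmZl oppr_le0.
by rewrite pmulr_rge0 //; case/andP: gamma_bounds.
Qed.

(** Testing each inequality with the other solution and adding gives <F y - F z, y - z> <= 0,
    against strong monotonicity. *)
Lemma VI_unique x y z : VI_solution (pseudo_grad G x) (feasible_set G x) y ->
  VI_solution (pseudo_grad G x) (feasible_set G x) z -> y = z.
Proof.
move=> [Yy /(_ z)] + [Yz /(_ y Yy)]; rewrite !dotvE => /(_ Yz) hy hz.
apply/eqP; rewrite -subr_eq0; apply/eqP/dotm_eq0/eqP; rewrite eq_le dotm_ge0 andbT.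
rewrite -(pmulr_rle0 _ mu_gt0).
move: (Fmono x y z) hy hz; rewrite sqr_enorm dotvE.
move: (pseudo_grad G x y) (pseudo_grad G x z) => f g mono hy hz.
apply: le_trans mono _; rewrite -opprB dotmNr in hy; rewrite dotmDl dotmNl.
by move: (dotm f _) (dotm g _) hy hz => ? ?; lra.
Qed.

Lemma linear_equilibrium : exists W w,
  [/\ forall x, unique (VI_solution (pseudo_grad G x) (feasible_set G x))
                       (W *m x + w),
      forall x, hmap G gamma x (W *m x + w) = W *m x + w
    & W = J2h G gamma *m W + J1h G gamma].
Proof.
have [J2 [J1 [h0 hE]]] := hmap_affine.
(* A vector fixed by the strict contraction J2 is zero; the transposes turn kernel rows into
   columns. *)
have unit_IJ : 1%:M - J2 \in unitmx.
  rewrite -unitmx_tr -row_free_unit; apply/inj_row_free => v vIJ0.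
  have Jv : J2 *m v^T = v^T.
    apply/eqP; rewrite eq_sym -subr_eq0 -[X in X - _]mul1mx -mulmxBl.
    by apply/eqP/trmx_inj; rewrite trmx_mul trmxK vIJ0 trmx0.
  apply: trmx_inj; rewrite trmx0; apply: enorm_eq0.
  have := J2h_contraction v^T.
  rewrite (J2hE hE) Jv -subr_le0 -{1}[enorm _]mul1r.
  rewrite -mulrBl pmulr_rle0 ?subr_gt0 ?hmap_lip_lt1 // => le0.
  by apply/eqP; rewrite eq_le le0 enorm_ge0.
(* Stated for any number of columns, to cover both W (B = J1) and w (B = h0). *)
have fixE q (B : 'M[R]_(_, q)) : J2 *m (invmx (1%:M - J2) *m B) + B =
                              invmx (1%:M - J2) *m B.
  have : (1%:M - J2) *m (invmx (1%:M - J2) *m B) = B.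
    by rewrite mulmxA mulmxV // mul1mx.
  by move: (invmx _ *m B) => X; rewrite mulmxBl mul1mx => <-; rewrite addrC subrK.
have [fixW fixw] := (fixE _ J1, fixE _ h0).
move: (invmx _ *m J1) (invmx _ *m h0) fixW fixw => W w fixW fixw.
have fixh x : hmap G gamma x (W *m x + w) = W *m x + w.
  by rewrite hE mulmxDr mulmxA (addrAC (J2 *m W *m x)) -mulmxDl fixW -addrA fixw.
exists W, w; split=> //.
  move=> x; split; first exact: hmap_fix_VI.
  by move=> y; apply: VI_unique; exact: hmap_fix_VI.
by rewrite (J2hE hE) (J1hE hE) fixW.
Qed.

End Equilibrium.

(** * Rates of convergence *)

Section LinearRates.
Variable R : realType.
Implicit Types u v a e delta : nat -> R.

Lemma linear_rate_le u v c : 0 <= c -> (forall k, u k <= c * v k) ->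
  linear_rate v -> linear_rate u.
Proof.
move=> c0 uv [C [rho [C0 /andP[r0 r1] vC]]]; exists ((c + 1) * C), rho.
rewrite r0 r1; split=> // [|k]; first by rewrite mulr_gt0 // ltr_wpDl.
rewrite (le_trans (uv k)) // -mulrA.
apply: le_trans (_ : c * (C * rho ^+ k) <= _); first by rewrite ler_wpM2l.
by rewrite ler_wpM2r ?lerDl // mulr_ge0 ?exprn_ge0 ?ltW.
Qed.

Lemma linear_rateD u v : linear_rate u -> linear_rate v ->
  linear_rate (fun k => u k + v k).
Proof.
move=> [C [rho [C0 /andP[r0 r1] uC]]] [D [s [D0 /andP[s0 s1] vD]]].
exists (C + D), (Num.max rho s); split; first exact: addr_gt0.
  by rewrite lt_max r0 gt_max r1.
move=> k; rewrite mulrDl lerD //.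
  apply: le_trans (uC k) _; rewrite ler_wpM2l ?(ltW C0) //.
  by apply: lerXn2r; rewrite ?nnegrE ?le_max ?lexx ?(ltW r0).
apply: le_trans (vD k) _; rewrite ler_wpM2l ?(ltW D0) //.
by apply: lerXn2r; rewrite ?nnegrE ?le_max ?lexx ?(ltW s0) ?orbT.
Qed.

(** From some index k0 on, the multiplicative perturbation leaves a factor below 1; the additive one
    is absorbed by adding a multiple of eta^k to u. The first k0 steps only affect the constant. *)
Lemma perturbed_linear_rate u r eta D :
  0 <= r < 1 -> 0 <= eta < 1 -> 0 <= D -> (forall k, 0 <= u k) ->
  (forall k, u k.+1 <= r * u k + D * eta ^+ k * (1 + u k)) -> linear_rate u.
Proof.
move=> /andP[r0 r1] /andP[eta0 eta1] D0 u0 rec.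
pose rho1 := (r + 1) / 2.
have [k0 small] : exists k0, forall k, (k0 <= k)%N -> r + D * eta ^+ k <= rho1.
  have cv : (fun k => r + D * eta ^+ k) @ \oo --> r.
    rewrite -[X in _ --> X]addr0 -[X in _ --> _ + X](mulr0 D).
    apply: cvgD; first exact: cvg_cst.
    apply: cvgM; first exact: cvg_cst.
    by apply: cvg_expr; rewrite ger0_norm.
  have : \forall k \near \oo, r + D * eta ^+ k <= rho1.
    by apply: (cvgr_le _ cv); rewrite /rho1; lra.
  by case=> k0 _ h; exists k0 => k /h.
pose theta := Num.max rho1 eta; pose rho := (1 + theta) / 2.
have theta1 : theta < 1 by rewrite gt_max eta1 andbT /rho1; lra.
have rho1_le : rho1 <= theta by rewrite le_max lexx.
have eta_le : eta <= theta by rewrite le_max lexx orbT.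
have theta_rho : theta < rho by rewrite /rho; lra.
have rho0 : 0 < rho by rewrite (le_lt_trans eta0) // (le_lt_trans eta_le).
have rho_lt1 : rho < 1 by rewrite /rho; lra.
(* M solves M eta + D = M rho, so that Z contracts by rho. *)
pose M := D / (rho - eta); pose Z k := u k + M * eta ^+ k.
have rho_eta : 0 < rho - eta by rewrite subr_gt0 (le_lt_trans eta_le).
have M0 : 0 <= M by rewrite divr_ge0 // ltW.
have Z0 k : 0 <= Z k by rewrite addr_ge0 // mulr_ge0 // exprn_ge0.
have Zrec k : (k0 <= k)%N -> Z k.+1 <= rho * Z k.
  move=> /small le_rho1; rewrite /Z exprS.
  have D_E : D = M * (rho - eta) by rewrite /M divfK // gt_eqF.
  have h1 : (r + D * eta ^+ k) * u k <= rho1 * u k by rewrite ler_wpM2r.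
  have h2 : rho1 * u k <= rho * u k.
    by rewrite ler_wpM2r // (le_trans rho1_le) // ltW.
  have := rec k; move: h1 h2; rewrite [in X in _ -> _ -> X -> _]D_E [in X in X -> _]D_E.
  move: (eta ^+ k) (u k) (u k.+1) => x y z; lra.
(* Dominates Z j / rho^j for every j <= k0; the 1 makes it positive. *)
pose C := 1 + \sum_(j < k0.+1) Z j / rho ^+ j.
have C0 : 0 < C.
  by rewrite ltr_pwDl // sumr_ge0 // => j _; rewrite divr_ge0 // exprn_ge0 // ltW.
exists C, rho; split=> //; first by rewrite rho0.
move=> k; apply: le_trans (_ : Z k <= _).
  by rewrite lerDl mulr_ge0 // exprn_ge0.
have first_le j : (j <= k0)%N -> Z j <= C * rho ^+ j.
  move=> jk0; rewrite -ler_pdivrMr ?exprn_gt0 //.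
  rewrite /C (bigD1 (Ordinal (jk0 : (j < k0.+1)%N))) //= addrCA lerDl.
  by rewrite addr_ge0 // sumr_ge0 // => i _; rewrite divr_ge0 // exprn_ge0 // ltW.
elim: k => [|k IH]; first exact: first_le.
have [/first_le //|k0k] := leqP k.+1 k0.
rewrite (le_trans (Zrec k k0k)) // exprS mulrCA; rewrite ler_wpM2l //; exact: ltW.
Qed.

(** A linear rate asks for a positive ratio while eta may be 0, so the unperturbed recursion with
    factor eta is used. *)
Lemma geometric_linear_rate (D eta : R) : 0 <= eta < 1 -> 0 <= D ->
  linear_rate (fun k => D * eta ^+ k).
Proof.
move=> eta01 D0; apply: (@perturbed_linear_rate _ eta 0 0) => //.
- by rewrite lexx ltr01.
- by move=> k; rewrite mulr_ge0 // exprn_ge0 //; case/andP: eta01.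
- by move=> k; rewrite !mul0r addr0 exprS mulrCA.
Qed.

Lemma coupled_linear_rate kappa eta K1 K2 :
  0 < kappa -> 0 <= eta < 1 -> 0 <= K1 -> 0 < K2 ->
  exists bbar : R, 0 < bbar /\ forall beta, 0 < beta < bbar ->
    forall a e delta D, (forall k, 0 <= a k) -> (forall k, 0 <= e k) ->
    0 <= D -> (forall k, delta k <= D * eta ^+ k) ->
    (forall k, a k.+1 <= (1 - beta * kappa) * a k +
       beta * K1 * (e k + delta k * (1 + a k + e k))) ->
    (forall k, e k.+1 <= eta * e k +
       beta * K2 * (a k + e k + delta k * (1 + a k + e k))) ->
    linear_rate (fun k => a k + e k).
Proof.
move=> kappa0 /andP[eta0 eta1] K10 K20.
(* With lam K2 = kappa / 2, the feedback of a through lam e costs half of the decay of a. The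
   condition beta S <= 1 - eta brings the coefficient of e below lam (1 - beta kappa / 2). *)
pose lam := kappa / (2 * K2); pose S := K1 / lam + K2 + kappa / 2.
have lam0 : 0 < lam by rewrite divr_gt0 // mulr_gt0.
have S0 : 0 < S.
  have : 0 <= K1 / lam by rewrite divr_ge0 // ltW.
  by rewrite /S; lra.
exists (Num.min kappa^-1 ((1 - eta) / S)); split.
  by rewrite lt_min invr_gt0 kappa0 divr_gt0 // subr_gt0.
move=> beta /andP[b0]; rewrite lt_min -(ltr_pM2r kappa0) mulVf ?gt_eqF //.
rewrite ltr_pdivlMr // => /andP[bk bS] a e delta D a0 e0 D0 deltaD reca rece.
pose c := 1 + lam^-1.
have li0 : 0 < lam^-1 by rewrite invr_gt0.
have lamK2 : lam * K2 = kappa / 2 by rewrite /lam; field; lra.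
have lamS : lam * S = K1 + lam * K2 + lam * (kappa / 2).
  by rewrite /S; field; lra.
have c0 : 0 <= c by rewrite /c; lra.
have K0 : 0 <= K1 + lam * K2 by rewrite addr_ge0 // mulr_ge0 // ltW.
have ae_le k : a k + e k <= c * (a k + lam * e k).
  have -> : c * (a k + lam * e k) =
            a k + e k + (lam^-1 * a k + lam * e k) by rewrite /c; field; lra.
  by rewrite lerDl addr_ge0 // mulr_ge0 // ltW.
apply: (@linear_rate_le _ (fun k => a k + lam * e k) c) => //.
apply: (@perturbed_linear_rate _ (1 - beta * kappa / 2) eta
  (beta * (K1 + lam * K2) * D * c)).
- by have := mulr_gt0 b0 kappa0; lra.
- by rewrite eta0.
- by rewrite mulr_ge0 // mulr_ge0 // mulr_ge0 // ltW.
- by move=> k; rewrite addr_ge0 // mulr_ge0 // ltW.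
move=> k.
set w := delta k * (1 + a k + e k); set V := a k + lam * e k.
have V0 : 0 <= V by rewrite addr_ge0 // mulr_ge0 // ltW.
have w_le : w <= D * eta ^+ k * (c * (1 + V)).
  apply: le_trans (_ : D * eta ^+ k * (1 + a k + e k) <= _).
    by rewrite ler_wpM2r // !addr_ge0.
  rewrite ler_wpM2l ?mulr_ge0 ?exprn_ge0 // mulrDr mulr1 -addrA.
  by rewrite lerD // /c; lra.
have bKw : beta * (K1 + lam * K2) * w <=
           beta * (K1 + lam * K2) * (D * eta ^+ k * (c * (1 + V))).
  by rewrite ler_wpM2l // mulr_ge0 // ltW.
have lam_rece := ler_wpM2l (ltW lam0) (rece k).
have coef_e : lam * eta + beta * (K1 + lam * K2) <= lam * (1 - beta * kappa / 2).
  have : lam * (beta * S) <= lam * (1 - eta) by rewrite ler_pM2l // ltW.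
  by rewrite mulrCA lamS; lra.
have {}coef_e := ler_wpM2r (e0 k) coef_e.
have b_a : beta * (lam * K2) * a k = beta * (kappa / 2) * a k by rewrite lamK2.
apply: le_trans (lerD (reca k) lam_rece) _.
rewrite -/w; move: bKw b_a coef_e; rewrite /V; lra.
Qed.

End LinearRates.

(** * The leader's step *)

Section ProjectedGradient.
Variables (R : realType) (m : nat) (f : 'cV[R]_m -> R) (g : 'cV[R]_m -> 'cV[R]_m).
Variables (sigma L alpha : R) (X : set 'cV[R]_m).
Hypothesis sigma_gt0 : 0 < sigma.
Hypothesis L_gt0 : 0 < L.
Hypothesis alpha_bounds : 0 < alpha <= L^-1.
Hypothesis f_sconvex : forall x d,
  f x + dotm (g x) d + sigma / 2 * dotm d d <= f (x + d).
Hypothesis g_lip : forall x x', enorm (g x - g x') <= L * enorm (x - x').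
Hypotheses (X_neq0 : X !=set0) (X_convex : convex_set X) (X_compact : compact X).

Lemma alphaL_le1 : alpha * L <= 1.
Proof.
by have /andP[_] := alpha_bounds; rewrite -(ler_pM2r L_gt0) mulVf // gt_eqF.
Qed.

Lemma dotm_gradB_le x d : dotm (g (x + d) - g x) d <= L * dotm d d.
Proof.
apply: le_trans (dotm_le _ _) _; rewrite -sqr_enorm expr2 mulrA.
by rewrite ler_wpM2r ?enorm_ge0 // (le_trans (g_lip _ _)) // addrC addKr.
Qed.

(* Since alpha * L <= 1, the quadratic upper bound with constant L (rather than
   L / 2) is enough here, and it needs only the first-order convexity
   inequality at the projected point. *)
Lemma projected_gradient_gap xs x : is_minimizer X f xs ->
  alpha * sigma / 2 * dotm (x - xs) (x - xs) <=
  dotm (x - eproj X (x - alpha *: g x)) (x - xs).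
Proof.
move=> [Xxs fmin].
have [] := proj_point_eproj (x - alpha *: g x) X_neq0 X_convex X_compact.
set u := eproj X _ => Xu /(_ _ Xxs) le0.
have := fmin _ Xu; have := f_sconvex x (xs - x); have := f_sconvex u (x - u).
have := dotm_gradB_le x (u - x); have := alphaL_le1.
have := dotm_ge0 (x - u); have /andP[a0 _] := alpha_bounds.
have -> : xs - x = - (x - xs) by rewrite opprB.
have -> : u - x = - (x - u) by rewrite opprB.
have -> : x - (x - xs) = xs by rewrite opprB addrCA subrr addr0.
have -> : x - (x - u) = u by rewrite opprB addrCA subrr addr0.
have -> : u + (x - u) = x by rewrite addrCA subrr addr0.
move: le0; have -> : xs - u = (x - u) - (x - xs).
  by rewrite opprB [RHS]addrC subrKA.
have -> : x - alpha *: g x - u = (x - u) - alpha *: g x by rewrite addrAC.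
move: (x - u) (x - xs) (g x) (g u) => d e gx gu.
rewrite !dotm_lin !opprK => le0 d0 aL lip fu fx fmin_u.
have sd : 0 <= sigma / 2 * dotm d d by rewrite mulr_ge0 // divr_ge0 // ltW.
(* The convexity inequalities from x to xs and from u to x are added, using f xs <= f u; replacing g
   u by g x costs L |d|^2, which the |d|^2 in the projection inequality covers after scaling by
   alpha. *)
have gap : sigma / 2 * dotm e e - L * dotm d d <= dotm gx e - dotm gx d by lra.
have {}gap := ler_wpM2l (ltW a0) gap.
have : alpha * L * dotm d d <= 1 * dotm d d by rewrite ler_wpM2r.
lra.
Qed.

(** By the angle condition this is first-order optimality, <g xs, v - xs> >= 0, obtained by moving
    from xs towards v. *)
Lemma projected_gradient_fixpoint xs : is_minimizer X f xs ->
  eproj X (xs - alpha *: g xs) = xs.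
Proof.
move=> [Xxs fmin]; have /andP[a0 _] := alpha_bounds.
apply: eproj_unique; split=> // v Xv.
rewrite addrAC subrr add0r dotmNl dotmZl oppr_le0 pmulr_rge0 // leNgt.
have Xseg t := convex_setP X_convex Xxs Xv (t := t).
apply/negP => neg; move: (v - xs) neg Xseg => d neg Xseg; set b := L * dotm d d.
have b0 : 0 <= b by rewrite mulr_ge0 ?dotm_ge0 // ltW.
(* Convexity at xs + t d, looking back to xs, and minimality give <g (xs + t d), d> >= 0; the
   Lipschitz bound returns to g xs. *)
have key t : 0 < t <= 1 -> 0 <= dotm (g xs) d + t * b.
  move=> /andP[t0 t1]; have t01 : 0 <= t <= 1 by rewrite ltW.
  have := fmin _ (Xseg t t01).
  have := f_sconvex (xs + t *: d) (- (t *: d)); rewrite addrK.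
  have := dotm_gradB_le xs (t *: d).
  move: (g (xs + _)) (f (xs + _)) => gz fz; rewrite !dotm_lin.
  rewrite -/b => lip fo le_f; have dd := dotm_ge0 d.
  have h1 : t * dotm gz d - t * dotm (g xs) d <= t * (t * b) by rewrite /b; lra.
  have h2 : 0 <= sigma / 2 * (t * (t * dotm d d)).
    by rewrite !mulr_ge0 // ltW // divr_gt0.
  by rewrite -(pmulr_rge0 _ t0); lra.
have c0 : 0 < b - dotm (g xs) d by lra.
(* With c = <g xs, d> < 0, this t lies in (0, 1] even if b = 0 and gives c + t b = - c^2 / (b - c) <
   0. *)
have := key (- dotm (g xs) d / (b - dotm (g xs) d)).
rewrite divr_gt0 ?oppr_gt0 // ler_pdivrMr // mul1r lerBrDl subrr b0 => /(_ isT).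
apply/negP; rewrite -ltNge -(pmulr_llt0 _ c0).
rewrite [ltLHS](_ : _ = - dotm (g xs) d ^+ 2); last by field; lra.
by rewrite oppr_lt0 exprn_even_gt0 //= lt_eqF.
Qed.

(** At a second minimizer, also a fixed point of the projected step, the right side of the gap
    inequality vanishes. *)
Lemma minimizer_unique xs xs' :
  is_minimizer X f xs -> is_minimizer X f xs' -> xs = xs'.
Proof.
move=> min_xs min_xs'; have /andP[a0 _] := alpha_bounds.
have := projected_gradient_gap xs' min_xs.
rewrite (projected_gradient_fixpoint min_xs') subrr dotm0l.
rewrite pmulr_rle0 ?divr_gt0 ?mulr_gt0 // => le0; apply/esym/eqP.
by rewrite -subr_eq0; apply/eqP/dotm_eq0/eqP; rewrite eq_le le0 dotm_ge0.
Qed.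

Variable xs : 'cV[R]_m.
Hypothesis min_xs : is_minimizer X f xs.

Let T x := eproj X (x - alpha *: g x).

Lemma projected_gradient_lip x gh :
  enorm (eproj X (x - alpha *: gh) - T x) <= alpha * enorm (gh - g x).
Proof.
have /andP[a0 _] := alpha_bounds.
have P z := proj_point_eproj z X_neq0 X_convex X_compact.
apply: le_trans (proj_point_lip (P _) (P _)) _.
have -> : x - alpha *: gh - (x - alpha *: g x) = alpha *: (g x - gh).
  by rewrite opprB addrC addrA subrK scalerBr addrC.
by rewrite enormZ gtr0_norm // enorm_distC.
Qed.

(** T fixes xs and is Lipschitz with constant 1 + alpha L <= 2; the triangle inequality adds 1. *)
Lemma projected_gradient_displacement x : enorm (T x - x) <= 3 * enorm (x - xs).
Proof.
have /andP[a0 _] := alpha_bounds.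
have P z := proj_point_eproj z X_neq0 X_convex X_compact.
have -> : T x - x = (T x - xs) - (x - xs) by rewrite opprB addrA subrK.
apply: le_trans (enormB _ _) _.
suff : enorm (T x - xs) <= 2 * enorm (x - xs) by lra.
rewrite -{1}(projected_gradient_fixpoint min_xs).
apply: le_trans (proj_point_lip (P _) (P _)) _.
have -> : x - alpha *: g x - (xs - alpha *: g xs) =
          (x - xs) - alpha *: (g x - g xs).
  by apply/matrixP => i j; rewrite !mxE; ring.
apply: le_trans (enormB _ _) _; rewrite enormZ gtr0_norm //.
have := ler_wpM2l (ltW a0) (g_lip x xs).
have := ler_wpM2r (enorm_ge0 (x - xs)) alphaL_le1; lra.
Qed.

Lemma relaxed_step_displacement beta x gh : 0 < beta ->
  enorm (beta *: (eproj X (x - alpha *: gh) - x)) <=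
  beta * (3 * enorm (x - xs) + alpha * enorm (gh - g x)).
Proof.
move=> b0; rewrite enormZ gtr0_norm // ler_pM2l //.
have -> : eproj X (x - alpha *: gh) - x =
          (T x - x) + (eproj X (x - alpha *: gh) - T x) by rewrite [RHS]addrC addrA subrK.
apply: le_trans (enormD _ _) _; apply: lerD.
  exact: projected_gradient_displacement.
exact: projected_gradient_lip.
Qed.

(** Without gradient error the squared distance shrinks by 1 - beta alpha sigma + 9 beta^2, at most
    1 - beta alpha sigma / 2, hence at most (1 - beta alpha sigma / 4)^2. *)
Lemma relaxed_step_contraction beta x gh : 0 < beta ->
  beta * 18 <= alpha * sigma -> beta * (alpha * sigma / 4) <= 1 ->
  enorm (x + beta *: (eproj X (x - alpha *: gh) - x) - xs) <=
  (1 - beta * (alpha * sigma / 4)) * enorm (x - xs) +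
  beta * (alpha * enorm (gh - g x)).
Proof.
move=> b0 b18 b1; have /andP[a0 _] := alpha_bounds.
have -> : x + beta *: (eproj X (x - alpha *: gh) - x) - xs =
    ((x - xs) + beta *: (T x - x)) + beta *: (eproj X (x - alpha *: gh) - T x).
  by apply/matrixP => i j; rewrite !mxE; ring.
apply: le_trans (enormD _ _) _; apply: lerD; last first.
  rewrite enormZ gtr0_norm // ler_pM2l //; exact: projected_gradient_lip.
have kappa0 : 0 <= 1 - beta * (alpha * sigma / 4) by lra.
apply: enorm_leP; first by rewrite mulr_ge0 ?enorm_ge0.
have gap := projected_gradient_gap x min_xs.
have : enorm (T x - x) ^+ 2 <= (3 * enorm (x - xs)) ^+ 2.
  rewrite ler_pXn2r ?nnegrE ?mulr_ge0 ?enorm_ge0 //.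
  exact: projected_gradient_displacement.
rewrite !exprMn !sqr_enorm; move: gap; rewrite -/(T x) -(opprB (T x) x) dotmNl.
have := dotm_ge0 (x - xs).
move: (x - xs) (T x - x) => d e d0 gap ee; rewrite !dotm_lin (dotmC d e).
have h1 : beta * (alpha * sigma / 2 * dotm d d) <= beta * - dotm e d.
  by rewrite ler_pM2l.
have h2 : beta ^+ 2 * dotm e e <= beta ^+ 2 * (3 ^+ 2 * dotm d d).
  by rewrite ler_pM2l ?exprn_gt0.
have h3 : beta * 18 * (beta * dotm d d) <= alpha * sigma * (beta * dotm d d).
  by rewrite ler_wpM2r // mulr_ge0 // ltW.
have h4 : 0 <= (beta * (alpha * sigma / 4)) ^+ 2 * dotm d d.
  by rewrite mulr_ge0 // sqr_ge0.
lra.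
Qed.

End ProjectedGradient.

Lemma mulmx_continuous (R : realType) p q (W : 'M[R]_(q, p)) :
  continuous (fun x : 'cV[R]_p => W *m x).
Proof.
have -> : (fun x : 'cV[R]_p => W *m x) =
          (fun x : 'cV[R]_p => \sum_k x k 0 *: col k W).
  apply/funext => x; rewrite {1}(cV_sum_delta x) mulmx_sumr.
  by apply: eq_bigr => k _; rewrite -scalemxAr colE.
have addC : continuous (fun u : 'cV[R]_q * 'cV[R]_q => u.1 + u.2).
  exact: add_continuous.
apply: (continuous_big addC) => k _ x.
apply: (@continuousZr_tmp _ _ _ (fun u : 'cV[R]_p => u k 0)).
exact: coord_continuous.
Qed.

(** * Error of the approximate hypergradient *)

Section HypergradientError.
Variables (R : realType) (p q : nat) (phi : 'cV[R]_p * 'cV[R]_q -> R) (L0 : R).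
Hypothesis L0_ge0 : 0 <= L0.
Hypothesis grad1_lip : forall z z',
  enorm (grad1 phi z - grad1 phi z') <= L0 * enorm2 (z - z').
Hypothesis grad2_lip : forall z z',
  enorm (grad2 phi z - grad2 phi z') <= L0 * enorm2 (z - z').

(** The bound on [grad2 phi] grows linearly away from the reference point over [xs], whence the
    factor 1 + |x - xs| + |y - y'| on the sensitivity error. *)
Lemma hypergrad_error (W : 'M[R]_(q, p)) w xs : exists K, 0 <= K /\
  forall x y s,
    enorm (hypergrad phi x y s - hypergrad phi x (W *m x + w) W) <=
    K * (enorm (y - (W *m x + w)) +
         enorm (s - W) * (1 + enorm (x - xs) + enorm (y - (W *m x + w)))).
Proof.
set G0 := enorm (grad2 phi (xs, W *m xs + w)).
pose L1 := L0 * (1 + enorm W).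
have L10 : 0 <= L1 by rewrite mulr_ge0 // addr_ge0 // enorm_ge0.
have G00 : 0 <= G0 by exact: enorm_ge0.
exists (L1 + G0); split=> [|x y s]; first exact: addr_ge0.
set y' := W *m x + w.
have -> : hypergrad phi x y s - hypergrad phi x y' W =
    (grad1 phi (x, y) - grad1 phi (x, y')) +
    W^T *m (grad2 phi (x, y) - grad2 phi (x, y')) +
    (s - W)^T *m grad2 phi (x, y).
  have -> : (s - W)^T = s^T - W^T by apply/matrixP => i j; rewrite !mxE.
  rewrite /hypergrad mulmxBl mulmxBr.
  by apply/matrixP => i j; rewrite !mxE; ring.
have e2 : enorm2 ((x, y) - (x, y')) <= enorm (y - y').
  by apply: le_trans (enorm2_le _) _; rewrite /= subrr enorm0 add0r.
have h1 : enorm (grad1 phi (x, y) - grad1 phi (x, y')) <= L0 * enorm (y - y').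
  by apply: le_trans (grad1_lip _ _) _; rewrite ler_wpM2l.
have h2 : enorm (W^T *m (grad2 phi (x, y) - grad2 phi (x, y'))) <=
          enorm W * (L0 * enorm (y - y')).
  apply: le_trans (enormM _ _) _; rewrite enorm_tr ler_wpM2l ?enorm_ge0 //.
  by apply: le_trans (grad2_lip _ _) _; rewrite ler_wpM2l.
have yxs : enorm (y - (W *m xs + w)) <=
           enorm (y - y') + enorm W * enorm (x - xs).
  have -> : y - (W *m xs + w) = (y - y') + W *m (x - xs).
    by rewrite /y' mulmxBr; apply/matrixP => i j; rewrite !mxE; ring.
  by apply: le_trans (enormD _ _) _; rewrite lerD2l enormM.
have h3 : enorm (grad2 phi (x, y)) <=
          G0 + L1 * (enorm (x - xs) + enorm (y - y')).
  rewrite -[grad2 phi (x, y)](subrK (grad2 phi (xs, W *m xs + w))) addrC.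
  apply: le_trans (enormD _ _) _; rewrite lerD2l.
  apply: le_trans (grad2_lip _ _) _; rewrite -mulrA ler_wpM2l //.
  apply: le_trans (enorm2_le _) _; rewrite /=.
  have : 0 <= enorm W * enorm (y - y') by rewrite mulr_ge0 ?enorm_ge0.
  by move: yxs; lra.
have h4 : enorm ((s - W)^T *m grad2 phi (x, y)) <=
          enorm (s - W) * (G0 + L1 * (enorm (x - xs) + enorm (y - y'))).
  apply: le_trans (enormM _ _) _; rewrite enorm_tr ler_wpM2l ?enorm_ge0 //.
apply: le_trans (enormD _ _) _.
apply: le_trans (lerD (le_trans (enormD _ _) (lerD h1 h2)) h4) _.
have := enorm_ge0 (s - W); have := enorm_ge0 (x - xs); have := enorm_ge0 (y - y').
move: (enorm (s - W)) (enorm (x - xs)) (enorm (y - y')) => d a e e0 a0 d0.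
have -> : L0 * e + enorm W * (L0 * e) = L1 * e by rewrite /L1; ring.
have -> : (L1 + G0) * (e + d * (1 + a + e)) =
    L1 * e + d * (G0 + L1 * (a + e)) + (G0 * e + d * L1 + d * (G0 * (a + e))).
  by ring.
rewrite lerDl; apply: addr_ge0; last by rewrite mulr_ge0 // mulr_ge0 // addr_ge0.
by apply: addr_ge0; rewrite mulr_ge0.
Qed.

End HypergradientError.

Lemma affine_graph_continuous (R : realType) p q (W : 'M[R]_(q, p)) w :
  continuous (fun x : 'cV[R]_p => (x, W *m x + w)).
Proof.
move=> x; have cvgW : W *m u + w @[u --> x] --> W *m x + w.
  apply: (@cvgD _ _ _ (nbhs x) _ (fun u => W *m u) (fun=> w)).
    exact: mulmx_continuous.
  exact: cvg_cst.
exact: (cvg_pair (f := id) (G := nbhs x) _ cvgW).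
Qed.

(** * Linear convergence of the single loop *)

Theorem theorem4 (R : realType) (m N : nat) (n p : 'I_N -> nat)
  (G : lq_game R m n p)
  (Qsym : forall i, (lqQ G i)^T = lqQ G i)
  (Qpos : forall i, posdefmx (lqQ G i))
  (Cfull : forall i, row_free (lqC G i))
  (fconvex : forall (i : 'I_N) (x : 'cV[R]_m) (y : 'Y[R]_n),
    convex_function setT (fun v => follower_cost G i x (subst_block y i v)))
  (mu : R) (mu_gt0 : 0 < mu)
  (Fmono : forall (x : 'cV[R]_m) (y y' : 'Y[R]_n),
    mu * enorm (y - y') ^+ 2 <=
    dotv (pseudo_grad G x y - pseudo_grad G x y') (y - y'))
  (LF : R)
  (Flip : forall (x : 'cV[R]_m) (y y' : 'Y[R]_n),
    enorm (pseudo_grad G x y - pseudo_grad G x y') <= LF * enorm (y - y'))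
  (S : forall k, set (set 'cV[R]_k)) (Somin : o_minimal S)
  (phi : 'cV[R]_m * 'Y[R]_n -> R)
  (phi_def : definable_fun2 S phi)
  (phi_diff : forall z, differentiable phi z)
  (phi_C1 : continuous (grad1 phi) /\ continuous (grad2 phi))
  (phi_lip : exists L1 L2 : R, forall z z',
    enorm (grad1 phi z - grad1 phi z') <= L1 * enorm2 (z - z') /\
    enorm (grad2 phi z - grad2 phi z') <= L2 * enorm2 (z - z'))
  (sigma : R) (sigma_gt0 : 0 < sigma)
  (phi_sconvex : strongly_convex2 sigma phi)
  (X : set 'cV[R]_m)
  (X_neq0 : X !=set0) (X_convex : convex_set X) (X_compact : compact X)
  (gamma : R) (gamma_bounds : 0 < gamma < 2 * mu / LF ^+ 2)
  (L : R) (L_gt0 : 0 < L)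
  (phie_lip : forall x x' : 'cV[R]_m,
    enorm (grad (phi_e G phi) x - grad (phi_e G phi) x') <= L * enorm (x - x'))
  (alpha : R) (alpha_bounds : 0 < alpha <= L^-1) :
  exists (W : 'M[R]_((\sum_i n i)%N, m)) (w : 'Y[R]_n),
    (forall x, unique (VI_solution (pseudo_grad G x) (feasible_set G x))
                      (W *m x + w)) /\
  exists xstar : 'cV[R]_m, unique (is_minimizer X (phi_e G phi)) xstar /\
  exists betabar : R, 0 < betabar /\
    forall beta : R, 0 < beta < betabar ->
    forall (x : nat -> 'cV[R]_m) (y : nat -> 'Y[R]_n)
           (s : nat -> 'M[R]_((\sum_i n i)%N, m)),
      X (x 0%N) ->
      single_loop_big_hype G phi X gamma (fun=> alpha) (fun=> beta) x y s ->
      linear_rate (fun k => Num.sqrt (enorm (x k - xstar) ^+ 2 +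
        enorm (y k - ystar G xstar) ^+ 2 + enorm (s k - W) ^+ 2)).
Proof.
have [W [w [VI fixh WE]]] :=
  linear_equilibrium Cfull mu_gt0 Fmono Flip gamma_bounds.
exists W, w; split=> //.
have ystarE x : ystar G x = W *m x + w.
  have [VIx uniqx] := VI x; apply: xget_unique => // y VIy.
  exact/esym/uniqx.
have phieE : phi_e G phi = fun x => phi (x, W *m x + w).
  by apply/funext => x; rewrite /phi_e ystarE.
have gradE x : grad (phi_e G phi) x = hypergrad phi x (W *m x + w) W.
  by rewrite phieE grad_affine_comp.
(* The joint modulus also yields sigma/2 |W d|^2, which is nonnegative and dropped. *)
have phie_sc x d : phi_e G phi x + dotm (grad (phi_e G phi) x) d +
    sigma / 2 * dotm d d <= phi_e G phi (x + d).
  have := strongly_convex_first_order phi_diff phi_sconvex (x, W *m x + w) d (W *m d).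
  rewrite sqr_enorm2 /= !sqr_enorm gradE phieE /hypergrad.
  rewrite dotmDl (dotm_mull W^T) trmxK mulrDr.
  have -> : (x, W *m x + w) + (d, W *m d) = (x + d, W *m (x + d) + w).
    by rewrite mulmxDr addrAC.
  have : 0 <= sigma / 2 * dotm (W *m d) (W *m d).
    by rewrite mulr_ge0 ?dotm_ge0 // divr_ge0 // ltW.
  lra.
have [xs min_xs] : exists xs, is_minimizer X (phi_e G phi) xs.
  have cont : continuous (phi_e G phi).
    rewrite phieE => x.
    apply: (continuous_comp (@affine_graph_continuous _ _ _ W w x)).
    exact: differentiable_continuous.
  have [xs] := compact_EVT_min X_neq0 X_compact (continuous_subspaceT cont).
  rewrite inE => Xxs minxs; exists xs; split=> // v Xv.
  by apply: minxs; rewrite inE.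
exists xs; split.
  split=> // xs' min_xs'.
  exact: (minimizer_unique sigma_gt0 L_gt0 alpha_bounds phie_sc phie_lip
    X_neq0 X_convex X_compact min_xs min_xs').
have [L1 [L2 lip12]] := phi_lip; pose L0 := `|L1| + `|L2|.
have L0_ge0 : 0 <= L0 by rewrite addr_ge0.
have lip1 z z' : enorm (grad1 phi z - grad1 phi z') <= L0 * enorm2 (z - z').
  have [le1 _] := lip12 z z'; apply: le_trans le1 _.
  rewrite ler_wpM2r ?sqrtr_ge0 // (le_trans (ler_norm _)) // lerDl //.
have lip2 z z' : enorm (grad2 phi z - grad2 phi z') <= L0 * enorm2 (z - z').
  have [_ le2] := lip12 z z'; apply: le_trans le2 _.
  rewrite ler_wpM2r ?sqrtr_ge0 // (le_trans (ler_norm _)) // lerDr //.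
have [K [K0 err_le]] := hypergrad_error L0_ge0 lip1 lip2 W w xs.
have /andP[a0 _] := alpha_bounds.
set eta := hmap_lip mu LF gamma.
have eta01 : 0 <= eta < 1 by rewrite sqrtr_ge0 (hmap_lip_lt1 gamma_bounds).
have /andP[eta0 eta1] := eta01.
pose kappa := alpha * sigma / 4.
have kappa0 : 0 < kappa by rewrite divr_gt0 // mulr_gt0.
(* The 3 is the displacement constant of the projected step; the final 1 keeps K2 positive when W =
   0. *)
pose K1 := alpha * K; pose K2 := enorm W * (3 + K1) + 1.
have K10 : 0 <= K1 by rewrite mulr_ge0 // ltW.
have W0 := enorm_ge0 W.
have K20 : 0 < K2 by rewrite ltr_wpDl // mulr_ge0 // addr_ge0.
have [bbar [bbar0 rate]] := coupled_linear_rate kappa0 eta01 K10 K20.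
(* The last two bounds are the step-size conditions of the relaxed contraction. *)
exists (Num.min bbar (Num.min (alpha * sigma / 18) kappa^-1)); split.
  by rewrite !lt_min bbar0 invr_gt0 kappa0 divr_gt0 // mulr_gt0.
move=> beta /andP[b0]; rewrite !lt_min => /and3P[bb b18 bk] x y s _ [xE yE sE].
have {}b18 : beta * 18 <= alpha * sigma by rewrite -ler_pdivlMr // ltW.
have {}bk : beta * kappa <= 1 by rewrite -ler_pdivlMr // div1r ltW.
pose a k := enorm (x k - xs); pose e k := enorm (y k - (W *m x k + w)).
pose delta k := enorm (s k - W).
have a_ge0 k : 0 <= a k by exact: enorm_ge0.
have e_ge0 k : 0 <= e k by exact: enorm_ge0.
have delta_ge0 k : 0 <= delta k by exact: enorm_ge0.
have delta_le k : delta k <= delta 0%N * eta ^+ k.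
  elim: k => [|k IH]; first by rewrite expr0 mulr1.
  rewrite /delta sE {1}WE opprD addrACA subrr addr0 -mulmxBr exprS mulrCA.
  apply: le_trans (_ : eta * delta k <= _); last by rewrite ler_wpM2l.
  apply: enorm_mulmx_le => // v.
  exact: (J2h_contraction Cfull Fmono Flip gamma_bounds).
have err k : enorm (hypergrad phi (x k) (y k) (s k) - grad (phi_e G phi) (x k)) <=
    K * (e k + delta k * (1 + a k + e k)).
  by rewrite gradE.
have aerr k := ler_wpM2l (ltW a0) (err k).
have ae_rate : linear_rate (fun k => a k + e k).
  apply: (rate beta _ a e delta (delta 0%N)) => // [|k|k]; first by rewrite b0.
    rewrite {1}/a xE; apply: le_trans (relaxed_step_contraction sigma_gt0 L_gt0
      alpha_bounds phie_sc phie_lip X_neq0 X_convex X_compact min_xs _ _ b0 b18 bk) _.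
    rewrite -/kappa -/(a k) lerD2l -mulrA ler_pM2l // /K1 -mulrA.
    exact: aerr.
  (* The map h(x^{k+1}, .) contracts towards its own fixed point, which has moved by W (x^{k+1} -
     x^k). *)
  have step : e k.+1 <= eta * (e k + enorm W * enorm (x k.+1 - x k)).
    rewrite {1}/e yE -{1}fixh.
    apply: le_trans (hmap_contraction Cfull Fmono Flip gamma_bounds _ _ _) _.
    rewrite ler_wpM2l //.
    have -> : y k - (W *m x k.+1 + w) =
              (y k - (W *m x k + w)) - W *m (x k.+1 - x k).
      by rewrite mulmxBr; apply/matrixP => i j; rewrite !mxE; ring.
    by apply: le_trans (enormB _ _) _; rewrite lerD2l enormM.
  have disp : enorm (x k.+1 - x k) <=
              beta * (3 * a k + K1 * (e k + delta k * (1 + a k + e k))).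
    rewrite xE addrAC subrr add0r.
    apply: le_trans (relaxed_step_displacement sigma_gt0 L_gt0 alpha_bounds phie_sc
      phie_lip X_neq0 X_convex X_compact min_xs _ _ b0) _.
    by rewrite ler_pM2l // lerD2l /K1 -mulrA; exact: aerr.
  apply: le_trans step _; rewrite mulrDr lerD2l.
  apply: le_trans (_ : enorm W * enorm (x k.+1 - x k) <= _).
    by rewrite ler_piMl ?mulr_ge0 ?enorm_ge0 // ltW.
  apply: le_trans (ler_wpM2l W0 disp) _.
  rewrite mulrCA -mulrA ler_pM2l //.
  set w' := delta k * _.
  have w'0 : 0 <= w' by rewrite mulr_ge0 // !addr_ge0.
  rewrite -subr_ge0 /K2.
  have -> : (enorm W * (3 + K1) + 1) * (a k + e k + w') -
      enorm W * (3 * a k + K1 * (e k + w')) =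
      enorm W * (3 * (e k + w') + K1 * a k) + (a k + e k + w') by ring.
  apply: addr_ge0; last by rewrite !addr_ge0.
  by apply: mulr_ge0 => //; apply: addr_ge0; apply: mulr_ge0 => //; rewrite addr_ge0.
(* The distance of y^k to the limit is at most e + |W| a, and a root of a sum of squares is at most
   the sum. *)
apply: (@linear_rate_le _ _ (fun k => (a k + e k) + delta 0%N * eta ^+ k)
  (1 + enorm W)); first by rewrite addr_ge0.
  move=> k; rewrite ystarE.
  have y_le : enorm (y k - (W *m xs + w)) <= e k + enorm W * a k.
    have -> : y k - (W *m xs + w) = (y k - (W *m x k + w)) + W *m (x k - xs).
      by rewrite mulmxBr; apply/matrixP => i j; rewrite !mxE; ring.
    by apply: le_trans (enormD _ _) _; rewrite lerD2l enormM.
  apply: le_trans (_ : a k + enorm (y k - (W *m xs + w)) + delta k <= _).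
    have := enorm_ge0 (y k - (W *m xs + w)).
    rewrite -/(a k) -/(delta k); move: (enorm _) => c c0.
    rewrite -[leRHS]ger0_norm ?addr_ge0 // -sqrtr_sqr ler_wsqrtr //.
    have -> : (a k + c + delta k) ^+ 2 = a k ^+ 2 + c ^+ 2 + delta k ^+ 2 +
      2 * (a k * c + a k * delta k + c * delta k) by ring.
    by rewrite lerDl mulr_ge0 // !addr_ge0 // mulr_ge0.
  have := delta_le k.
  have : 0 <= enorm W * (e k + delta 0%N * eta ^+ k).
    by rewrite mulr_ge0 // addr_ge0 // mulr_ge0 // exprn_ge0.
  by move: y_le; lra.
apply: linear_rateD => //; exact: geometric_linear_rate.
Qed.
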